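(* For all positive integers $N$ and all $N$-point sets $\mathcal{P} \subset [0,1)^2$, the discrepancy function $D_{\mathcal{P}}$ of $\mathcal{P}$ satisfies $$ \| D_{\mathcal{P}} \mid L_2 \| \ge c \sqrt{\log N} \qquad\text{with}\qquad c = \frac{7}{216\,\sqrt{\log 2}} = 0.038925\ldots .$$
   Context: $\log$ denotes the natural logarithm. For a finite set $\mathcal{P}\subset[0,1)^2$ with $N$ (distinct) points, the discrepancy function is defined for $x=(x_1,x_2)\in[0,1)^2$ by $$ D_{\mathcal{P}}(x) = \sum_{z\in\mathcal{P}} \mathbf{1}_{C_z}(x) - N\,|B_x|, $$ where $|B_x| = x_1x_2$ is the area of the rectangle $B_x=[0,x_1)\times[0,x_2)$ and $\mathbf{1}_{C_z}$ is the characteristic function of $C_z=(z_1,1)\times(z_2,1)$ for $z=(z_1,z_2)$ (so the sum is the number of points of $\mathcal{P}$ in $B_x$). The $L_2$-discrepancy of $\mathcal{P}$ is $\|D_{\mathcal{P}} \mid L_2\| = \left(\int_{[0,1)^2} D_{\mathcal{P}}(x)^2\,dx\right)^{1/2}$. *)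

(* Defs.v *)
From HB Require Import structures.
From mathcomp Require Import all_boot all_order all_algebra.
From mathcomp Require Import finmap.
From mathcomp Require Import all_classical all_reals all_analysis.
Set Implicit Arguments.
Unset Strict Implicit.
Unset Printing Implicit Defensive.
Import Order.TTheory GRing.Theory Num.Theory.
Import numFieldNormedType.Exports.
Local Open Scope classical_set_scope.
Local Open Scope ring_scope.

Definition unit_square (R : realType) : set (R * R) := `[0, 1[ `*` `[0, 1[.
Arguments unit_square R : clear implicits.

Definition upper_box (R : realType) (z : R * R) : set (R * R) :=
  `]z.1, 1[ `*` `]z.2, 1[.

(* For x in the unit square, x.1 * x.2 is the area of [0, x.1) x [0, x.2). *)
Definition discrepancy (R : realType) (P : {fset R * R}) (x : R * R) : R :=
  (\sum_(z <- P) \1_(upper_box z) x) - #|` P|%:R * (x.1 * x.2).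

(* The integrand is bounded and measurable, so the real-valued integral is the
   Lebesgue integral; no default value is involved. *)
Definition L2_discrepancy (R : realType) (P : {fset R * R}) : R :=
  Num.sqrt (\int[(@lebesgue_measure R \x @lebesgue_measure R)%E]_(x in unit_square R)
              (discrepancy P x ^+ 2)).

Definition disc_const (R : realType) : R := 7 / (216 * Num.sqrt (ln 2)).

(* Main.v *)
(* For fixed x, integrate y |-> D(x, y) against the Haar function of the dyadic
   interval I = ]m / 2^i, (m + 1) / 2^i[ in y. As a function of x the coefficient
   is N x / (4 4^i) plus a step function that jumps only at points of P lying in
   the strip over I, because a point outside I contributes a constant on I.
   A function of slope s with at most k jumps on [0, 1] has squared L2 norm at least
   s^2 / (12 (k + 1)^2). Summing over the 2^i intervals of level i, with Bessel's
   inequality in y and convexity in k, every level with 2^i <= N contributes at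
   least 1/768 to the squared norm. There are more than log_2 N such levels, and
   (7/216)^2 <= 1/768. *)

Require Import Defs.
From HB Require Import structures.
From mathcomp Require Import all_boot all_order all_algebra.
From mathcomp Require Import finmap.
From mathcomp Require Import all_classical all_reals all_analysis.
From mathcomp Require Import measurable_realfun zify ring lra.
Import Order.TTheory GRing.Theory Num.Theory.
Import numFieldNormedType.Exports.
Local Open Scope classical_set_scope.
Local Open Scope ring_scope.

(** * Affine functions with jumps, cut at their jumps *)

(* A pair q in ps is a jump of height q.2 at position q.1. *)
Definition steps {R : realType} (s : R) (ps : seq (R * R)) (x : R) : R :=
  s * x + \sum_(q <- ps) q.2 * (q.1 < x)%R%:R.

Definition steps_primitive {R : realType} (s : R) (ps : seq (R * R)) (x : R) : R :=
  s * x ^+ 2 / 2 + \sum_(q <- ps) q.2 * Num.max 0 (x - q.1).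

Lemma measurable_steps {R : realType} (s : R) (ps : seq (R * R)) :
  measurable_fun setT (steps s ps).
Proof.
apply: measurable_funD; first exact: measurable_funM.
apply: measurable_sum => q; apply: measurable_funM => //.
apply: (measurableT_comp (f := fun b : bool => b%:R : R)) => //.
exact: measurable_fun_ltr.
Qed.

Lemma measurable_steps_sqr {R : realType} (s : R) (ps : seq (R * R)) (D : set R) :
  measurable_fun D (fun x => (steps s ps x ^+ 2)%:E).
Proof.
apply/measurable_EFinP; apply: measurable_funX.
by apply: (measurable_funS _ (@subsetT _ D)) => //; exact: measurable_steps.
Qed.

(** The two terms are the squared mean and the variance, each times the length. The slope bound
    below keeps only the variance, the mean bound only the mean. *)
Lemma integral_affine_sqr {R : realType} (s d a b : R) : a < b ->
  (\int[lebesgue_measure]_(x in `]a, b[) ((s * x + d) ^+ 2)%:E =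
   ((b - a) * (s * (a + b) / 2 + d) ^+ 2 + s ^+ 2 * (b - a) ^+ 3 / 12)%:E)%E.
Proof.
move=> ab.
pose F (x : R) := s ^+ 2 / 3 * x ^+ 3 + s * d * x ^+ 2 + d ^+ 2 * x.
have dF (x : R) : is_derive x 1 F ((s * x + d) ^+ 2).
  rewrite /F; apply: is_derive_eq.
  rewrite /GRing.scale /=; by field.
have cF : continuous F.
  by move=> x; apply: differentiable_continuous; apply/derivable1_diffP.
have cf : continuous (fun x : R => (s * x + d) ^+ 2).
  by move=> x; apply: differentiable_continuous; apply/derivable1_diffP.
rewrite -(@integral_itv_bndoo _ a b _ true false).
  rewrite (@continuous_FTC2 _ _ F) //.
  - by rewrite -EFinB; congr EFin; rewrite /F; field.
  - by apply: continuous_subspaceT.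
  - split.
    + by move=> x _; apply: ex_derive.
    + by apply: cvg_at_right_filter; exact: cF.
    + by apply: cvg_at_left_filter; exact: cF.
  - by move=> x _; rewrite derive1E; apply: derive_val.
apply/measurable_EFinP; apply: (measurable_funS _ (@subsetT _ _)) => //.
exact: continuous_measurable_fun.
Qed.
(** Dropping the point [p] cannot increase the integral of a nonnegative function; the inequality
    avoids any argument on null sets. *)
Lemma ge0_integral_cut {R : realType} (f : R -> \bar R) (a p b : R) :
  a <= p -> p <= b -> measurable_fun `]a, b[ f ->
  (forall x, x \in `]a, b[ -> (0 <= f x)%E) ->
  (\int[lebesgue_measure]_(x in `]a, p[) f x + \int[lebesgue_measure]_(x in `]p, b[) f x
   <= \int[lebesgue_measure]_(x in `]a, b[) f x)%E.
Proof.
move=> ap pb mf f0.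
have sub : `]a, p[ `|` `]p, b[ `<=` `]a, b[.
  move=> x [] /=; rewrite !in_itv /= => /andP[h1 h2]; apply/andP; split => //.
    exact: lt_le_trans pb.
  exact: le_lt_trans h1.
rewrite -ge0_integral_setU//.
- by apply: ge0_subset_integral => //; exact: measurableU.
- exact: measurable_funS mf.
- by move=> x /sub; exact: f0.
- apply/disj_set2P; rewrite -subset0 => x [] /=; rewrite !in_itv /=.
  by move=> /andP[_ h1] /andP[h2 _]; have := lt_trans h1 h2; rewrite ltxx.
Qed.

(** The inequality is strict because [q] itself lies in neither part; this drives the induction on
    the number of jumps. *)
Lemma count_split {R : realType} (ps : seq (R * R)) (a b : R) (q : R * R) :
  q \in ps -> q.1 \in `]a, b[ ->
  (count (fun r => r.1 \in `]a, q.1[) ps + count (fun r => r.1 \in `]q.1, b[) ps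
   < count (fun r => r.1 \in `]a, b[) ps)%N.
Proof.
move=> qps; rewrite in_itv /= => /andP[aq qb].
have hq : (0 < count (fun r => r.1 == q.1) ps)%N.
  by rewrite -has_count; apply/hasP; exists q.
suff h : (count (fun r => r.1 \in `]a, q.1[) ps +
          count (fun r => r.1 \in `]q.1, b[) ps +
          count (fun r => r.1 == q.1) ps <= count (fun r => r.1 \in `]a, b[) ps)%N.
  by apply: leq_trans h; rewrite -addn1 leq_add2l.
elim: ps {qps hq} => //= r ps IH.
set A := count _ _ in IH *; set B := count _ _ in IH *.
set C := count _ _ in IH *; set D := count _ _ in IH *.
suff : ((r.1 \in `]a, q.1[) + (r.1 \in `]q.1, b[) + (r.1 == q.1) <= (r.1 \in `]a, b[))%N.
  move: IH; rewrite -/A; move: (nat_of_bool _) (nat_of_bool _) (nat_of_bool _) (nat_of_bool _). by lia.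
rewrite !in_itv /=; have [rq|rq|->] := ltgtP r.1 q.1.
- by rewrite (lt_trans rq qb) !andbT; case: (a < r.1).
- by rewrite (lt_trans aq rq) !andbF /=; case: (r.1 < b).
- by rewrite aq qb !andbF.
Qed.

Lemma steps_affine {R : realType} (s : R) (ps : seq (R * R)) (a b x : R) :
  (forall q, q \in ps -> q.1 \notin `]a, b[) -> x \in `]a, b[ ->
  steps s ps x = s * x + \sum_(q <- ps) q.2 * (q.1 <= a)%R%:R.
Proof.
move=> hps; rewrite in_itv /= => /andP[ax xb]; congr (_ + _).
apply: eq_big_seq => q /hps; rewrite in_itv /= negb_and -!leNgt => hq.
congr (_ * _%:R); congr nat_of_bool; apply/idP/idP => [qx|qa].
  by case/orP: hq => // bq; have := lt_trans qx xb; rewrite ltNge bq.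
exact: le_lt_trans ax.
Qed.

(** * Lower bounds for integrals of squares *)

(* A lower bound that holds between consecutive jumps and is subadditive under
   cutting an interval at a jump holds everywhere. *)
Lemma integral_steps_sqr_ge {R : realType} (G : R -> R -> R) (s : R) (ps : seq (R * R)) :
  (forall a b, a < b -> (forall q, q \in ps -> q.1 \notin `]a, b[) ->
     G a b <= (b - a) * (s * (a + b) / 2 + \sum_(q <- ps) q.2 * (q.1 <= a)%R%:R) ^+ 2
              + s ^+ 2 * (b - a) ^+ 3 / 12) ->
  (forall a b q, q \in ps -> q.1 \in `]a, b[ -> G a b <= G a q.1 + G q.1 b) ->
  forall a b, a < b ->
  ((G a b)%:E <= \int[lebesgue_measure]_(x in `]a, b[) (steps s ps x ^+ 2)%:E)%E.
Proof.
move=> Gaff Gsplit a b.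
(* Strong induction on the number of jumps inside the interval, for all intervals at once. *)
have [n] := ubnP (count (fun r => r.1 \in `]a, b[) ps).
elim: n a b => // n IH a b cn ab.
have [/hasP[q qps qab]|/hasPn noq] := boolP (has (fun r => r.1 \in `]a, b[) ps).
  have cs : (count (fun r => r.1 \in `]a, q.1[) ps + count (fun r => r.1 \in `]q.1, b[) ps < n)%N.
    by rewrite -ltnS; apply: leq_trans cn; rewrite ltnS; exact: count_split.
  have [aq qb] : a < q.1 /\ q.1 < b by move: qab; rewrite in_itv /= => /andP.
  apply: (@le_trans _ _ ((G a q.1)%:E + (G q.1 b)%:E)%E).
    by rewrite -EFinD lee_fin; exact: Gsplit.
  apply: (le_trans (leeD (IH a q.1 _ aq) (IH q.1 b _ qb))); 
    [exact: leq_ltn_trans (leq_addr _ _) cs|exact: leq_ltn_trans (leq_addl _ _) cs|].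
  apply: ge0_integral_cut; rewrite ?(ltW aq) ?(ltW qb)//.
    exact: measurable_steps_sqr.
  by move=> x _; rewrite lee_fin sqr_ge0.
under eq_integral.
  move=> x; rewrite inE /= => xab; rewrite (steps_affine s ps a b)//; over.
by rewrite integral_affine_sqr// lee_fin; exact: Gaff.
Qed.

(** Convexity of the cube: the left side is its tangent at [l]. *)
Lemma tangent_cube {R : realType} (r l : R) : 0 <= r -> 0 <= l ->
  3 * l ^+ 2 * r - 2 * l ^+ 3 <= r ^+ 3.
Proof.
move=> r0 l0; rewrite -subr_ge0.
have -> : r ^+ 3 - (3 * l ^+ 2 * r - 2 * l ^+ 3) = (r - l) ^+ 2 * (r + 2 * l) by ring.
by rewrite mulr_ge0 ?sqr_ge0// addr_ge0// mulr_ge0.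
Qed.

(* 3 l^2 L - 2 l^3 k is the tangent bound of the convex function L^3 / k^2 at L / k = l;
   unlike that function it is additive when an interval is cut at a jump. *)
Lemma integral_steps_sqr_ge_slope {R : realType} (s l : R) (ps : seq (R * R)) (a b : R) :
  0 <= l -> a < b ->
  ((s ^+ 2 / 12 * (3 * l ^+ 2 * (b - a)
      - 2 * l ^+ 3 * (count (fun q => q.1 \in `]a, b[) ps).+1%:R))%:E <=
   \int[lebesgue_measure]_(x in `]a, b[) (steps s ps x ^+ 2)%:E)%E.
Proof.
move=> l0.
pose G (a b : R) := s ^+ 2 / 12 * (3 * l ^+ 2 * (b - a)
      - 2 * l ^+ 3 * (count (fun q => q.1 \in `]a, b[) ps).+1%:R).
apply: (integral_steps_sqr_ge G) => {a b} [a b ab noq|a b q qps qab]; rewrite /G.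
  set d := \sum_(q <- ps) _.
  have -> : count (fun q => q.1 \in `]a, b[) ps = 0%N.
    by apply/eqP; rewrite -leqn0 leqNgt -has_count; apply/hasPn.
  rewrite -[X in X <= _]add0r; apply: lerD.
    by rewrite mulr_ge0 ?sqr_ge0// subr_ge0 ltW.
  rewrite mulr1 [X in _ <= X]mulrAC ler_wpM2l ?divr_ge0 ?sqr_ge0//.
  by rewrite tangent_cube// subr_ge0 ltW.
rewrite -mulrDr ler_wpM2l ?divr_ge0 ?sqr_ge0//.
have := count_split ps a b q qps qab.
set A := count _ _; set B := count _ _; set C := count _ _ => cs.
(* The cut uses up one jump, which pays for the extra successor: pieces add up. *)
have {cs} : (A.+1 + B.+1)%:R <= C.+1%:R :> R by rewrite ler_nat; lia.
rewrite natrD => cs.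
have l3 : 0 <= l ^+ 3 by exact: exprn_ge0.
have := ler_wpM2l l3 cs; rewrite mulrDr.
lra.
Qed.

(** Cauchy-Schwarz against the constant 1, [steps_primitive s ps] being a primitive of [steps s ps].
    Linearizing the square at the mean makes the bound additive under cuts. *)
Lemma integral_steps_sqr_ge_mean {R : realType} (s : R) (ps : seq (R * R)) (a b : R) :
  a < b ->
  (((steps_primitive s ps b - steps_primitive s ps a) ^+ 2 / (b - a))%:E <=
   \int[lebesgue_measure]_(x in `]a, b[) (steps s ps x ^+ 2)%:E)%E.
Proof.
move=> ab; pose F := steps_primitive s ps.
pose c := (F b - F a) / (b - a).
have -> : (F b - F a) ^+ 2 / (b - a) = 2 * c * (F b - F a) - c ^+ 2 * (b - a).
  by rewrite /c; field; rewrite subr_eq0 gt_eqF.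
(* [c] must stay fixed while the interval shrinks, so it is detached from the endpoints. *)
move: (c) ab => {}c.
pose G (a b : R) := 2 * c * (F b - F a) - c ^+ 2 * (b - a).
apply: (integral_steps_sqr_ge G) => {a b} [a b ab noq|a b q _ _]; rewrite /G; last first.
  by lra.
set d := \sum_(q <- ps) _.
have -> : F b - F a = (b - a) * (s * (a + b) / 2 + d).
  rewrite /F /steps_primitive /d mulrDr big_distrr /= opprD addrACA -sumrB.
  congr (_ + _); first by field.
  apply: eq_big_seq => q /noq; rewrite in_itv /= negb_and -!leNgt => hq.
  case: (leP q.1 a) => [qa|aq] /=.
    rewrite !max_r ?subr_ge0 ?(le_trans qa (ltW ab))//; by ring.
  have bq : b <= q.1 by case/orP: hq => //; rewrite leNgt aq.
  by rewrite !max_l ?subr_le0// ?(ltW aq)//; ring.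
have ba : 0 < b - a by rewrite subr_gt0.
set m := s * (a + b) / 2 + d.
rewrite -subr_ge0.
have -> : (b - a) * m ^+ 2 + s ^+ 2 * (b - a) ^+ 3 / 12
  - (2 * c * ((b - a) * m) - c ^+ 2 * (b - a)) =
  (b - a) * (m - c) ^+ 2 + (s * (b - a)) ^+ 2 * (b - a) / 12 by field.
by apply: addr_ge0; rewrite ?divr_ge0// mulr_ge0 ?sqr_ge0// ltW.
Qed.

(** * Dyadic intervals, Haar coefficients and Bessel's inequality *)

Lemma ge0_integral_pieces {R : realType} (f : R -> \bar R) (h : R) (k : nat) :
  0 < h -> measurable_fun setT f -> (forall x, (0 <= f x)%E) ->
  (\sum_(0 <= m < k) \int[lebesgue_measure]_(x in `](m%:R / h)%R, (m.+1%:R / h)%R[) f x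
   <= \int[lebesgue_measure]_(x in `]0%R, (k%:R / h)%R[) f x)%E.
Proof.
move=> h0 mf f0; elim: k => [|k IH].
  by rewrite big_geq// integral_ge0.
rewrite big_nat_recr//=; apply: (le_trans (leeD2r _ IH)).
apply: ge0_integral_cut => //.
- by rewrite divr_ge0// ltW.
- by rewrite ler_pM2r ?invr_gt0// ler_nat.
- exact: (measurable_funS _ (@subsetT _ _)).
Qed.

Lemma count_pieces {R : realType} (ts : seq R) (h : R) (k : nat) : 0 < h ->
  (\sum_(0 <= m < k) count (fun t => t \in `](m%:R / h), (m.+1%:R / h)[) ts <= size ts)%N.
Proof.
move=> h0.
(* The sharper bound, by the entries left of the last endpoint, makes the induction work: the next
   interval is disjoint from them. *)
suff H : (\sum_(0 <= m < k) count (fun t => t \in `](m%:R / h), (m.+1%:R / h)[) ts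
          <= count (fun t => t < k%:R / h)%R ts)%N.
  by apply: leq_trans H _; exact: count_size.
elim: k => [|k IH]; first by rewrite big_geq.
rewrite big_nat_recr//=; apply: (leq_trans (leq_add IH (leqnn _))).
have kk : k%:R / h <= k.+1%:R / h by rewrite ler_pM2r ?invr_gt0// ler_nat.
rewrite -count_predUI.
have -> : count (predI (fun t => (t < k%:R / h)%R)
    (fun t => t \in `](k%:R / h), (k.+1%:R / h)[)) ts = 0%N.
  apply/eqP; rewrite -leqn0 leqNgt -has_count; apply/hasPn => t _ /=.
  by rewrite in_itv /=; apply/negP => /and3P[h1 h2 _]; have := lt_trans h1 h2; rewrite ltxx.
rewrite addn0; apply: sub_count => t /=; rewrite in_itv /= => /orP[tk|/andP[]//].
exact: lt_le_trans kk.
Qed.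

Lemma big_nat_double {R : realType} (f : nat -> R) (k : nat) :
  \sum_(0 <= m < k.*2) f m = \sum_(0 <= m < k) (f m.*2 + f m.*2.+1).
Proof.
elim: k => [|k IH]; first by rewrite !big_geq.
by rewrite doubleS !big_nat_recr//= IH addrA.
Qed.

(* When F is a primitive of f, this is the integral of f against the Haar function
   equal to 1 on the left half of the dyadic interval and to -1 on the right half. *)
Definition haar {R : realType} (F : R -> R) (i m : nat) : R :=
  2 * F (m.*2.+1%:R / 2 ^+ i.+1) - F (m%:R / 2 ^+ i) - F (m.+1%:R / 2 ^+ i).

(** By the parallelogram law, halving the intervals of level [n] adds exactly the Haar terms of that
    level. Only the base case loses something, the squared mean over the unit interval. *)
Lemma haar_bessel {R : realType} (F : R -> R) (n : nat) :
  \sum_(0 <= i < n) \sum_(0 <= m < 2 ^ i) 2 ^+ i * haar F i m ^+ 2 <=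
  \sum_(0 <= m < 2 ^ n) 2 ^+ n * (F (m.+1%:R / 2 ^+ n) - F (m%:R / 2 ^+ n)) ^+ 2.
Proof.
elim: n => [|n IH].
  by rewrite big_geq// sumr_ge0// => m _; rewrite mulr_ge0 ?sqr_ge0.
rewrite big_nat_recr//= expnS mul2n big_nat_double.
apply: (le_trans (lerD IH (lexx _))); rewrite -big_split /=.
apply: ler_sum => m _; rewrite le_eqVlt; apply/orP; left; apply/eqP.
have e (j : nat) : j.*2%:R / 2 ^+ n.+1 = j%:R / 2 ^+ n :> R.
  by rewrite -muln2 natrM exprSr; field; rewrite expf_neq0.
rewrite /haar -doubleS !e.
move: (F (m%:R / _)) (F (m.+1%:R / _)) (F (m.*2.+1%:R / _)) => u v w.
by rewrite (exprS _ n); ring.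
Qed.

(** Cauchy-Schwarz on each interval of level [n] bounds the integral below by the squared means, to
    which [haar_bessel] applies. *)
Lemma integral_steps_sqr_ge_haar {R : realType} (s : R) (ps : seq (R * R)) (n : nat) :
  ((\sum_(0 <= i < n) \sum_(0 <= m < 2 ^ i)
      2 ^+ i * haar (steps_primitive s ps) i m ^+ 2)%:E <=
   \int[lebesgue_measure]_(x in `]0%R, 1%R[) (steps s ps x ^+ 2)%:E)%E.
Proof.
have p0 : 0 < 2 ^+ n :> R by rewrite exprn_gt0.
apply: (le_trans (y := (\sum_(0 <= m < 2 ^ n)
   \int[lebesgue_measure]_(x in `](m%:R / 2 ^+ n)%R, (m.+1%:R / 2 ^+ n)%R[)
     (steps s ps x ^+ 2)%:E)%E)); last first.
  have e1 : (2 ^ n)%N%:R / 2 ^+ n = 1 :> R by rewrite natrX divff ?gt_eqF.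
  rewrite -[X in `]0%R, X[]e1.
  apply: (ge0_integral_pieces (fun x => (steps s ps x ^+ 2)%:E) _ _ p0).
    exact: measurable_steps_sqr.
  by move=> x; rewrite lee_fin sqr_ge0.
have hb := haar_bessel (steps_primitive s ps) n.
rewrite -lee_fin in hb; apply: (le_trans hb).
rewrite -sumEFin; apply: lee_sum => m _.
have ab : m%:R / 2 ^+ n < m.+1%:R / 2 ^+ n :> R by rewrite ltr_pM2r ?invr_gt0// ltr_nat.
apply: le_trans (integral_steps_sqr_ge_mean s ps _ _ ab).
rewrite lee_fin le_eqVlt; apply/orP; left; apply/eqP.
rewrite -[X in X = _](mulrC) -mulrBl -natrB// subSnn.
by field; rewrite gt_eqF.
Qed.

(** * Haar coefficients of the discrepancy function *)

(** The ramp [Num.max 0 (y - z.2)] is a primitive of the indicator of [z.2 < y], so each height is a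
    Haar coefficient of that indicator. *)
Definition haar_jumps {R : realType} (P : seq (R * R)) (i m : nat) : seq (R * R) :=
  [seq (z.1, haar (fun y => Num.max 0 (y - z.2)) i m)
     | z <- P & z.2 \in `]m%:R / 2 ^+ i, m.+1%:R / 2 ^+ i[].

(** [haar] is minus a second difference: the quadratic term of the primitive in [y] yields the slope
    in [x], and a ramp that is affine on the dyadic interval yields 0. *)
Lemma haar_steps_primitive {R : realType} (P : seq (R * R)) (c x : R) (i m : nat) :
  haar (steps_primitive (- (c * x)) [seq (z.2, (z.1 < x)%R%:R) | z <- P]) i m =
  steps (c / (4 * 4 ^+ i)) (haar_jumps P i m) x.
Proof.
have p0 : 0 < 2 ^+ i :> R by rewrite exprn_gt0.
have mid : (m.*2.+1%:R : R) / 2 ^+ i.+1 = (m%:R / 2 ^+ i + m.+1%:R / 2 ^+ i) / 2.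
  rewrite -addn1 -muln2 natrD natrM exprS -(addn1 m) natrD.
  by field; rewrite gt_eqF.
have len : m.+1%:R / 2 ^+ i - m%:R / 2 ^+ i = (2 ^+ i)^-1 :> R.
  by rewrite -mulrBl -natrB// subSnn mul1r.
rewrite /steps /haar_jumps big_map big_filter big_mkcond /=.
rewrite /haar /steps_primitive mid.
set a := m%:R / _; set b := m.+1%:R / _ in len *.
rewrite !big_map /=.
have -> : \sum_(z <- P) (if z.2 \in `]a, b[ then
     (2 * Num.max 0 ((a + b) / 2 - z.2) - Num.max 0 (a - z.2) - Num.max 0 (b - z.2))
       * (z.1 < x)%R%:R else 0) =
   2 * (\sum_(z <- P) (z.1 < x)%R%:R * Num.max 0 ((a + b) / 2 - z.2))
   - (\sum_(z <- P) (z.1 < x)%R%:R * Num.max 0 (a - z.2))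
   - (\sum_(z <- P) (z.1 < x)%R%:R * Num.max 0 (b - z.2)).
  rewrite mulr_sumr -!sumrB; apply: eq_bigr => z _.
  have ab : a < b by rewrite -subr_gt0 len invr_gt0.
  case: ifPn => [_|]; first by ring.
  rewrite in_itv /= negb_and -!leNgt => /orP[za|bz].
    by rewrite !max_r; [field|lra|lra|lra].
  by rewrite !max_l; [ring|lra|lra|lra].
have -> : c / (4 * 4 ^+ i) * x = c * x * (b - a) ^+ 2 / 4.
  rewrite len (_ : 4 ^+ i = (2 ^+ i) ^+ 2); first by field; rewrite gt_eqF.
  by rewrite -exprM mulnC exprM (_ : 2 ^+ 2 = 4)//; ring.
by field.
Qed.

Lemma size_haar_jumps {R : realType} (P : seq (R * R)) (i m : nat) :
  size (haar_jumps P i m) =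
  count (fun t => t \in `]m%:R / 2 ^+ i, m.+1%:R / 2 ^+ i[) [seq z.2 | z <- P].
Proof. by rewrite size_map size_filter count_map. Qed.

(** The tangent bound is linear in the number of jumps, so with one [l] for the whole level only
    their total matters, and it is at most [size P]. *)
Lemma level_lower_bound {R : realType} (P : seq (R * R)) (i : nat) :
  (2 ^ i <= size P)%N ->
  ((1 / 768 : R)%:E <= \sum_(0 <= m < 2 ^ i) \int[lebesgue_measure]_(x in `]0%R, 1%R[)
     (2 ^+ i * steps ((size P)%:R / (4 * 4 ^+ i)) (haar_jumps P i m) x ^+ 2)%:E)%E.
Proof.
move=> iN; set N : R := (size P)%:R; set K : R := 2 ^+ i.
have K0 : 0 < K by rewrite exprn_gt0.
have KN : K <= N by rewrite /K -natrX ler_nat.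
have N0 : 0 < N by exact: lt_le_trans KN.
(* The best l is K / (N + K); since K <= N, this simpler value is good enough. *)
pose l := K / (2 * N).
have l0 : 0 <= l by rewrite divr_ge0// ?mulr_ge0// ltW.
pose s := N / (4 * 4 ^+ i).
pose B m := K * (s ^+ 2 / 12 * (3 * l ^+ 2 - 2 * l ^+ 3 * (size (haar_jumps P i m)).+1%:R)).
apply: (@le_trans _ _ (\sum_(0 <= m < 2 ^ i) (B m)%:E)%E); last first.
  apply: lee_sum => m _; under eq_integral do rewrite EFinM.
  rewrite ge0_integralZl//; last 3 first.
  - exact: measurable_steps_sqr.
  - by move=> x _; rewrite lee_fin sqr_ge0.
  - by rewrite lee_fin ltW.
  rewrite /B EFinM; apply: lee_wpmul2l; first by rewrite lee_fin ltW.
  apply: le_trans (integral_steps_sqr_ge_slope s l (haar_jumps P i m) 0 1 l0 ltr01).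
  rewrite lee_fin subr0 mulr1 ler_wpM2l ?divr_ge0 ?sqr_ge0// lerB// ler_wpM2l//.
    by rewrite mulr_ge0// exprn_ge0.
  by rewrite ler_nat ltnS count_size.
rewrite sumEFin lee_fin /B -!mulr_sumr sumrB sumr_const_nat subn0 -mulr_sumr.
have cnt : \sum_(0 <= m < 2 ^ i) (size (haar_jumps P i m)).+1%:R <= N + K.
  rewrite /N /K -natrX -natrD -natr_sum ler_nat.
  under eq_bigr do rewrite -addn1.
  rewrite big_split /= sum_nat_const_nat subn0 muln1 leq_add2r.
  under eq_bigr do rewrite size_haar_jumps.
  by rewrite (leq_trans (count_pieces _ _ _ K0))// size_map.
have l3 : 0 <= 2 * l ^+ 3 by rewrite mulr_ge0// exprn_ge0.
have cl := ler_wpM2l l3 cnt.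
have e4 : 4 ^+ i = K ^+ 2.
  by rewrite /K -exprM mulnC exprM (_ : 2 ^+ 2 = 4)//; ring.
apply: (@le_trans _ _ (K * (s ^+ 2 / 12 * (3 * l ^+ 2 * K - 2 * l ^+ 3 * (N + K))))).
  (* For [s = N / (4 * K ^+ 2)] and [l = K / (2 * N)] this intermediate value is exactly 1/768. *)
  apply: (@le_trans _ _ (K * (s ^+ 2 / 12 * (K * l ^+ 2)))).
    rewrite /s /l e4 le_eqVlt; apply/orP; left; apply/eqP; field.
    by rewrite !gt_eqF.
  rewrite ler_pM2l// ler_wpM2l ?divr_ge0 ?sqr_ge0//.
  have -> : 3 * l ^+ 2 * K - 2 * l ^+ 3 * (N + K) = K * l ^+ 2 + K * l ^+ 2 * (1 - K / N).
    by rewrite /l; field; rewrite gt_eqF.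
  rewrite lerDl; apply: mulr_ge0; first by rewrite mulr_ge0 ?sqr_ge0// ltW.
  by rewrite subr_ge0 ler_pdivrMr// mul1r.
rewrite ler_pM2l// ler_wpM2l ?divr_ge0 ?sqr_ge0// lerB//.
by rewrite -[_ *+ 2 ^ i]mulr_natr natrX.
Qed.

(** * Sections and integrability of the discrepancy function *)

Lemma discrepancy_steps {R : realType} (P : {fset R * R}) (x y : R) :
  x < 1 -> y < 1 ->
  discrepancy P (x, y) =
  steps (- (#|` P|%:R * x)) [seq (z.2, (z.1 < x)%R%:R) | z <- P] y.
Proof.
move=> x1 y1; rewrite /discrepancy /steps big_map /= addrC mulNr mulrA; congr (_ + _).
apply: eq_bigr => z _; rewrite indicE /upper_box -natrM mulnb; congr (_%:R).
congr nat_of_bool; apply/idP/idP => [|/andP[h1 h2]].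
  by rewrite inE /= !in_itv /= => -[/andP[-> _] /andP[-> _]].
by rewrite inE /=; split; rewrite /= in_itv /= ?h1 ?h2 ?x1 ?y1.
Qed.

Lemma measurable_unit_square {R : realType} : measurable (unit_square R).
Proof. exact: measurableX. Qed.

Lemma measurable_discrepancy {R : realType} (P : {fset R * R}) :
  measurable_fun setT (@discrepancy R P).
Proof.
apply: measurable_funB.
  apply: measurable_sum => z; apply: measurable_indic.
  exact: measurableX.
by apply: measurable_funM => //; exact: measurable_funM.
Qed.

Lemma integrable_discrepancy_sqr {R : realType} (P : {fset R * R}) :
  (@lebesgue_measure R \x @lebesgue_measure R)%E.-integrable (unit_square R)
    (EFin \o (fun x => discrepancy P x ^+ 2)).
Proof.
apply: measurable_bounded_integrable.
- exact: measurable_unit_square.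
- have m1 : lebesgue_measure (`[0, 1[ : set R) = 1%E.
    by rewrite lebesgue_measure_itv /= lte_fin ltr01 sube0.
  have m2 : ((@lebesgue_measure R \x @lebesgue_measure R) (`[0%R, 1%R[ `*` `[0%R, 1%R[)
             = 1 * 1)%E.
    by rewrite product_measure1E//; congr (_ * _)%E; exact: m1.
  by apply: (@le_lt_trans _ _ 1%E); [rewrite -[X in (_ <= X)%E]mule1 -m2|exact: ltry].
- apply: measurable_funX; apply: (measurable_funS _ (@subsetT _ _)) => //.
  exact: measurable_discrepancy.
(* On the unit square, the point count and the area term are each at most the number of points. *)
- exists ((2 * #|` P|%:R) ^+ 2); split=> [|M /ltW PM [x y] []] /=; first exact: num_real.
  rewrite !in_itv /= => /andP[x0 x1] /andP[y0 y1]; apply: le_trans PM.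
  rewrite normrX lerXn2r ?nnegrE// ?mulr_ge0// /discrepancy.
  apply: (le_trans (ler_normB _ _)); rewrite mulrDl mul1r lerD//.
    apply: (le_trans (ler_norm_sum _ _ _)).
    rewrite -sum1_size natr_sum; apply: ler_sum => z _.
    by rewrite indicE; case: (_ \in _); rewrite ?normr1 ?normr0.
  rewrite normrM normr_nat ler_piMr//.
  by rewrite ger0_norm ?mulr_ge0// mulr_ile1 ?(ltW x1) ?(ltW y1).
Qed.

(** * Numerical bounds for log 2 *)

Lemma is_derive_artanh {R : realType} (u : R) : -1 < u -> u < 1 ->
  is_derive u 1 (fun x => ln (1 + x) - ln (1 - x)) (2 / (1 - u ^+ 2)).
Proof.
move=> u1 u2.
have p1 : 0 < 1 + u by lra.
have p2 : 0 < 1 - u by lra.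
have d1 : is_derive (1 + u) 1 (@ln R) (1 + u)^-1 by exact: is_derive1_ln.
have d2 : is_derive (1 - u) 1 (@ln R) (1 - u)^-1 by exact: is_derive1_ln.
have e1 : is_derive u 1 (fun x => ln (1 + x)) (1 + u)^-1.
  have := is_derive1_comp (f := @ln R) (g := fun x => 1 + x) (x := u).
  move=> h; apply: (is_derive_eq (h _ _ d1 _)); by ring.
have e2 : is_derive u 1 (fun x => ln (1 - x)) (- (1 - u)^-1).
  have := is_derive1_comp (f := @ln R) (g := fun x => 1 - x) (x := u).
  move=> h; apply: (is_derive_eq (h _ _ d2 _)); by ring.
apply: is_derive_eq; rewrite opprK; field.
by rewrite !gt_eqF//; have := mulr_gt0 p1 p2; lra.
Qed.

Lemma ln2_bounds {R : realType} : 69 / 10 ^+ 2 + 313 / 10 ^+ 5 < ln (2 : R) < 69 / 10 ^+ 2 + 315 / 10 ^+ 5.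
Proof.
(* ln 2 = ln ((1 + u) / (1 - u)) at u = 1/3. *)
pose S (u : R) := 2 * (u + u ^+ 3 / 3 + u ^+ 5 / 5 + u ^+ 7 / 7).
pose A (u : R) := ln (1 + u) - ln (1 - u).
have lnA : ln 2 = A (1 / 3).
  rewrite /A -ln_div ?posrE; [|lra|lra].
  by congr ln; field.
(* [S] holds the first four terms of the series of [A]; [k * u ^+ 9] is a trial remainder, and the
   mean value theorem gives the sign of [f k (1 / 3)]. *)
pose f (k u : R) := A u - (S u + k * u ^+ 9).
have df (k u : R) : -1 < u -> u < 1 ->
    is_derive u 1 (f k) (2 * u ^+ 8 / (1 - u ^+ 2) - 9 * k * u ^+ 8).
  move=> u1 u2; have dA := is_derive_artanh u u1 u2.
  have u0 : 1 - u ^+ 2 != 0 by rewrite gt_eqF//; nra.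
  have dS : is_derive u 1 (fun x => S x + k * x ^+ 9)
      (2 * (1 + u ^+ 2 + u ^+ 4 + u ^+ 6) + 9 * k * u ^+ 8).
    by apply: is_derive_eq; rewrite /GRing.scale /=; field.
  by apply: is_derive_eq; field.
have c2 (c : R) : 0 <= c -> c <= 1 / 3 -> 8 / 9 <= 1 - c ^+ 2.
  move=> c0 c1; have c3 : 0 <= c * (1 / 3 - c) by rewrite mulr_ge0// subr_ge0.
  by lra.
have key (k : R) : exists2 c, c \in `[0, 1 / 3] &
    f k (1 / 3) - f k 0 = (2 * c ^+ 8 / (1 - c ^+ 2) - 9 * k * c ^+ 8) * (1 / 3 - 0).
  apply: MVT_segment; first by lra.
    by move=> x; rewrite in_itv /= => /andP[x0 x1]; apply: df; lra.
  apply: derivable_within_continuous => x; rewrite in_itv /= => /andP[x0 x1].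
  have x2 : -1 < x by lra.
  have x3 : x < 1 by lra.
  by have [] := df k x x2 x3.
have f0 (k : R) : f k 0 = 0 by rewrite /f /A /S addr0 subr0 ln1 !expr0n /=; lra.
rewrite lnA; apply/andP; split.
  have [c] := key 0; rewrite in_itv /= f0 => /andP[c0 c1] e.
  have : 0 <= 2 * c ^+ 8 / (1 - c ^+ 2).
    by rewrite divr_ge0 ?mulr_ge0 ?exprn_ge0// (le_trans _ (c2 c c0 c1)).
  move: e; rewrite /f /S; lra.
(* On [[0, 1 / 3]] one has 2 / (1 - c^2) <= 9/4 = 9k, whence k = 1/4. *)
have [c] := key (1 / 4); rewrite in_itv /= f0 => /andP[c0 c1] e.
have : 2 * c ^+ 8 / (1 - c ^+ 2) <= 9 / 4 * c ^+ 8.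
  have h : 0 < 1 - c ^+ 2 by rewrite (lt_le_trans _ (c2 c c0 c1)).
  rewrite ler_pdivrMr// [X in _ <= X]mulrAC ler_wpM2r ?exprn_ge0//.
  by have := c2 c c0 c1; lra.
move: e; rewrite /f /S; lra.
Qed.

(** * Tonelli's theorem and summation over the levels *)

Lemma inner_integral_ge {R : realType} (P : {fset R * R}) (n : nat) (x : R) : x < 1 ->
  ((\sum_(0 <= i < n) \sum_(0 <= m < 2 ^ i)
      2 ^+ i * steps (#|` P|%:R / (4 * 4 ^+ i)) (haar_jumps P i m) x ^+ 2)%:E <=
   \int[lebesgue_measure]_(y in `]0%R, 1%R[) (discrepancy P (x, y) ^+ 2)%:E)%E.
Proof.
move=> x1; under eq_integral.
  move=> y; rewrite inE /= in_itv /= => /andP[_ y1].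
  rewrite discrepancy_steps//; over.
under eq_bigr do under eq_bigr do rewrite -haar_steps_primitive.
exact: integral_steps_sqr_ge_haar.
Qed.

Lemma integral_discrepancy_sqr_ge {R : realType} (P : {fset R * R}) (n : nat) :
  (2 ^ n <= #|` P|)%N ->
  n.+1%:R / 768 <=
  \int[(@lebesgue_measure R \x @lebesgue_measure R)%E]_(x in unit_square R)
    (discrepancy P x ^+ 2).
Proof.
move=> nP; rewrite -lee_fin /Rintegral fineK; last first.
  apply: integrable_fin_num; first exact: measurable_unit_square.
  exact: integrable_discrepancy_sqr.
(* Extension by zero to the plane, where Tonelli's theorem gives an iterated integral. *)
rewrite integral_mkcond.
pose g := (fun z : R * R => (discrepancy P z ^+ 2)%:E) \_ (unit_square R).
have mg : measurable_fun setT g.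
  apply/(measurable_restrictT _ measurable_unit_square).
  apply/measurable_EFinP; apply: measurable_funX.
  by apply: (measurable_funS _ (@subsetT _ _)) => //; exact: measurable_discrepancy.
have g0 z : (0 <= g z)%E by rewrite /g erestrict_ge0// => y _; rewrite lee_fin sqr_ge0.
rewrite [leRHS](_ : _ = \int[lebesgue_measure]_x fubini_F lebesgue_measure g x)%E;
  last exact: fubini_tonelli1.
pose h i m (x : R) := 2 ^+ i * steps (#|` P|%:R / (4 * 4 ^+ i)) (haar_jumps P i m) x ^+ 2.
have h0 i m x : (0 <= (h i m x)%:E)%E by rewrite lee_fin mulr_ge0 ?sqr_ge0.
have mh i m D : measurable_fun D (fun x => (h i m x)%:E).
  apply/measurable_EFinP; apply: measurable_funM => //.
  by apply/measurable_EFinP; exact: measurable_steps_sqr.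
apply: (@le_trans _ _ (\int[lebesgue_measure]_(x in `]0%R, 1%R[)
   \sum_(0 <= i < n.+1) \sum_(0 <= m < 2 ^ i) (h i m x)%:E)%E).
  rewrite ge0_integral_sum//; last 2 first.
  - by move=> i; apply: emeasurable_sum => m; exact: mh.
  - by move=> i x _; apply: sume_ge0 => m _; exact: h0.
  have -> : n.+1%:R / 768 = \sum_(0 <= i < n.+1) (1 / 768 : R).
    by rewrite sumr_const_nat subn0 -[RHS]mulr_natl mul1r.
  rewrite -sumEFin big_seq [leRHS]big_seq; apply: lee_sum => i.
  rewrite mem_index_iota /= ltnS => iN.
  rewrite ge0_integral_sum//; last by move=> m; exact: mh.
  apply: level_lower_bound; apply: leq_trans nP.
  by rewrite leq_exp2l.
have mF : measurable_fun setT (fubini_F lebesgue_measure g).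
  exact: measurable_fun_fubini_tonelli_F.
(* Shrinking the line to the open unit interval only lowers the integral. *)
apply: (@le_trans _ _ (\int[lebesgue_measure]_(x in `]0%R, 1%R[) fubini_F lebesgue_measure g x)%E);
  last first.
  apply: ge0_subset_integral => //.
  by move=> x _; exact: integral_ge0.
apply: ge0_le_integral => //.
- by move=> x _; apply: sume_ge0 => i _; apply: sume_ge0 => m _; exact: h0.
- by apply: emeasurable_sum => i; apply: emeasurable_sum => m; exact: mh.
- exact: measurable_funTS.
move=> x /=; rewrite in_itv /= => /andP[x0 x1].
apply: (@le_trans _ _ (\int[lebesgue_measure]_(y in `]0%R, 1%R[) (discrepancy P (x, y) ^+ 2)%:E)%E).
  apply: le_trans (inner_integral_ge P n.+1 x x1).
  by under eq_bigr do rewrite sumEFin; rewrite sumEFin.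
rewrite [leLHS](_ : _ = \int[lebesgue_measure]_(y in `]0%R, 1%R[) g (x, y))%E.
  apply: ge0_subset_integral => //.
  exact: measurableT_comp.
apply: eq_integral => y; rewrite inE /= in_itv /= => /andP[y0 y1].
rewrite /g patchE mem_set//=; split; rewrite /= in_itv /=.
  by rewrite (ltW x0).
by rewrite (ltW y0).
Qed.

(** * The constant and the final estimate *)

Lemma disc_const_bounds {R : realType} :
  38 / 10 ^+ 3 + 925 / 10 ^+ 6 <= disc_const R < 38 / 10 ^+ 3 + 926 / 10 ^+ 6.
Proof.
have /andP[l1 l2] := @ln2_bounds R.
rewrite /disc_const; set t := Num.sqrt _.
have t2 : t * t = ln 2 by rewrite -expr2 sqr_sqrtr//; lra.
have t0 : 0 < t by rewrite sqrtr_gt0; lra.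
(* 0.832540 and 0.832558 have squares just outside the bounds for log 2, so they enclose its square
   root. *)
have u1 : 832 / 10 ^+ 3 + 540 / 10 ^+ 6 < t.
  rewrite ltNge; apply/negP => h.
  have := ler_pM (ltW t0) (ltW t0) h h; rewrite t2; lra.
have u2 : t < 832 / 10 ^+ 3 + 558 / 10 ^+ 6.
  rewrite ltNge; apply/negP => h.
  have h0 : 0 <= 832 / 10 ^+ 3 + 558 / 10 ^+ 6 :> R by lra.
  have := ler_pM h0 h0 h h; rewrite t2; lra.
apply/andP; split.
  rewrite ler_pdivlMr ?mulr_gt0//; lra.
rewrite ltr_pdivrMr ?mulr_gt0//; lra.
Qed.

Theorem theorem1 (R : realType) :
  (forall (N : nat) (P : {fset R * R}),
      (0 < N)%N -> #|` P| = N -> [set` P] `<=` unit_square R ->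
      disc_const R * Num.sqrt (ln N%:R) <= L2_discrepancy P) /\
  38 / 10 ^+ 3 + 925 / 10 ^+ 6 <= disc_const R < 38 / 10 ^+ 3 + 926 / 10 ^+ 6.
Proof.
split; last exact: disc_const_bounds.
move=> N P N0 PN _; rewrite /L2_discrepancy.
(* Levels 0 to [n] give [n.+1] contributions, enough since log N <= (n + 1) log 2. *)
pose n := trunc_log 2 N.
have n1 : (2 ^ n <= N)%N by exact: trunc_logP.
have n2 : (N < 2 ^ n.+1)%N by exact: trunc_log_ltn.
apply: (le_trans _ (ler_wsqrtr (integral_discrepancy_sqr_ge P n _))); last by rewrite PN.
have l2 : 0 < ln (2 : R) by rewrite ln_gt0// ltr1n.
have lN : ln (N%:R : R) <= n.+1%:R * ln 2.
  rewrite mulr_natl -lnXn// ler_ln ?posrE ?ltr0n ?exprn_gt0// -natrX ler_nat.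
  exact: ltnW.
rewrite /disc_const.
have -> : 7 / (216 * Num.sqrt (ln 2)) * Num.sqrt (ln N%:R) =
   Num.sqrt (49 / (216 * 216) * (ln N%:R / ln 2)) :> R.
  have -> : 49 / (216 * 216) = (7 / 216) ^+ 2 :> R by field.
  rewrite sqrtrM ?sqr_ge0// sqrtr_sqr ger0_norm// sqrtrM ?ln_ge0 ?ler1n// sqrtrV ?(ltW l2)//.
  field.
  by rewrite gt_eqF// sqrtr_gt0.
apply: ler_wsqrtr.
have lN' : ln (N%:R : R) / ln 2 <= n.+1%:R by rewrite ler_pdivrMr.
have n0 : 0 <= n.+1%:R :> R by [].
(* 49 * 768 = 37632 is below 216 * 216 = 46656. *)
lra.
Qed.
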